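(* Let $T_{q_0}$, with $T=\langle X_n,Q_T,\pi_T,\lambda_T\rangle$, be an initial one-way synchronizing transducer representing a homeomorphism of $\mathfrak{C}_n$, with inverse $S_{(\epsilon,q_0)}$. Then $V_n^{T_{q_0}^{-1}}=\mathcal{H}(TS)$, where $V_n^{T_{q_0}^{-1}}=T_{q_0}V_nT_{q_0}^{-1}$. If $T$ is synchronous, then moreover $V_n^{T_{q_0}^{-1}}=V_n(\mathcal{G}(TS))$.
   Context: Words. $n\ge 2$, $X_n=\{0,\dots,n-1\}$; $X_n^*$ is the set of finite words over $X_n$, $\epsilon$ the empty word, $X_n^k$ the set of words of length $k$; $\mathfrak{C}_n=X_n^\omega$ is Cantor space, $H(\mathfrak{C}_n)$ its homeomorphism group; for $\alpha\in X_n^*$ the cone $[\alpha]$ is the set of elements of $\mathfrak{C}_n$ with prefix $\alpha$. If $u$ is a prefix of $v$, $v-u$ denotes the word $\mu$ with $v=u\mu$. Functions are written to the right of their arguments and composed left to right; $h^g=g^{-1}hg$. A maximal antichain of $X_n^*$ is a finite set of words whose cones partition $\mathfrak{C}_n$. Transducers. A transducer $T=\langle X_n,Q,\pi,\lambda\rangle$ consists of a finite state set $Q$ and functions $\pi:X_n\times Q\to Q$ (transition), $\lambda:X_n\times Q\to X_n^*$ (output), extended to words by $\pi(\epsilon,q)=q$, $\lambda(\epsilon,q)=\epsilon$, $\pi(xw,q)=\pi(w,\pi(x,q))$, $\lambda(xw,q)=\lambda(x,q)\lambda(w,\pi(x,q))$ (and $\lambda$ likewise to infinite words). For a state $q$,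 $T_q$ denotes the initial transducer started at $q$, identified with the map $\mathfrak{C}_n\to\mathfrak{C}_n$, $\delta\mapsto\lambda(\delta,q)$ (outputs on infinite words being infinite); $\mathrm{im}(q)$ is the image of this map. $T$ is synchronous if $\lambda(x,q)\in X_n$ for all $x\in X_n$ and all states $q$. The product $TR$ of transducers has state set $Q_T\times Q_R$, with $\lambda_{TR}(i,(t,r))=\lambda_R(\lambda_T(i,t),r)$ and $\pi_{TR}(i,(t,r))=(\pi_T(i,t),\pi_R(\lambda_T(i,t),r))$; thus $(TR)_{(t,r)}$ is $T_t$ followed by $R_r$. Inverse. Suppose $T_{q_0}$ is a homeomorphism and every state of $T$ is accessible from $q_0$ (i.e. equals $\pi(w,q_0)$ for some $w\in X_n^*$). For a state $q$ and $\alpha\in X_n^*$ let $\mathcal{L}_q(\alpha)$ be the longest common prefix of all words in the preimage of $[\alpha]$ under $T_q$. The inverse $S_{(\epsilon,q_0)}$ of $T_{q_0}$ has initial state $(\epsilon,q_0)$; its states are the pairs $(w,q)\in X_n^*\times Q$ accessible from $(\epsilon,q_0)$ under, for $x\in X_n$, $\lambda_S(x,(w,q))=\mathcal{L}_q(wx)$ and $\pi_S(x,(w,q))=\big(wx-\lambda(\mathcal{L}_q(wx),q),\ \pi(\mathcal{L}_q(wx),q)\big)$. There are finitely many such states, and $S_{(\epsilon,q_0)}$ induces $T_{q_0}^{-1}$. Synchronization. $T$ is synchronizing at level $k$ if there is $f:X_n^k\to Q$ with $\pi(\alpha,q)=f(\alpha)$ for all $\alpha\in X_n^k$, $q\in Q$;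 synchronizing if so at some level; one-way synchronizing if it is synchronizing but its inverse $S$ is not. $V_n$ is the generalised Thompson group: the homeomorphisms $v$ of $\mathfrak{C}_n$ for which there are maximal antichains $\{\alpha_1,\dots,\alpha_l\}$, $\{\beta_1,\dots,\beta_l\}$ with $(\alpha_i\chi)v=\beta_i\chi$ for all $i$ and all $\chi\in\mathfrak{C}_n$. The group $\mathcal{H}(T)$. A transducer $T$ is partially invertible if for every state $q$ the map $T_q$ is injective with clopen image; for $T,S$ as in the claim, $TS$ is partially invertible. A viable combination of a partially invertible $T$ is a pair of tuples $((\rho_1,\dots,\rho_l),(p_1,\dots,p_l))$ of (not necessarily distinct or incomparable) words $\rho_i\in X_n^*$ and (not necessarily distinct) states $p_i$ of $T$ such that $\bigcup_i\rho_i\,\mathrm{im}(p_i)=\mathfrak{C}_n$ and $\rho_i\,\mathrm{im}(p_i)\cap\rho_j\,\mathrm{im}(p_j)=\emptyset$ for $i\neq j$. If $l\equiv 1\pmod{n-1}$, choose any maximal antichain $\{\eta_1,\dots,\eta_l\}$ of $X_n^*$; the homeomorphism $h$ of $\mathfrak{C}_n$ with $(\eta_i\chi)h=\rho_i(\chi)T_{p_i}$ for all $i$, $\chi\in\mathfrak{C}_n$, is called a completion of $T$. $\mathcal{H}(T)$ is the subgroup of $H(\mathfrak{C}_n)$ generated by all completions of $T$ in $H(\mathfrak{C}_n)$. The group $V_n(\mathcal{G}(T))$. For a synchronous transducer $T$ whose states all induce homeomorphisms, $\mathcal{G}(T)$ is the subgroup of $H(\mathfrak{C}_n)$ generated by all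 $T_q$, $q$ a state of $T$. For $\alpha\in X_n^*$ and $g\in\mathcal{G}(T)$, $[\alpha]_g$ is the homeomorphism with $(\alpha\chi)[\alpha]_g=\alpha(\chi)g$ for $\chi\in\mathfrak{C}_n$ and fixing all points outside $[\alpha]$. Then $V_n(\mathcal{G}(T))=\langle V_n,\{[\alpha]_g:\alpha\in X_n^*,\,g\in\mathcal{G}(T)\}\rangle$. *)

(* Defs.v *)
From mathcomp Require Import all_boot.
From mathcomp Require Import all_classical topology.

Set Implicit Arguments.
Unset Strict Implicit.
Unset Printing Implicit Defensive.

Local Open Scope classical_set_scope.

Notation word n := (seq 'I_n).

Definition cantor (n : nat) : Type :=
  prod_topology (fun _ : nat => discrete_topology 'I_n).


(* The default value given to [nth] is the letter of [d] that follows [a]. *)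
Definition wcat n (a : word n) (d : cantor n) : cantor n :=
  fun k => nth (d (k - size a) : 'I_n) a k.

Definition is_prefix n (a : word n) (d : cantor n) : Prop :=
  mkseq d (size a) = a.

Definition cone n (a : word n) : set (cantor n) := [set d | is_prefix a d].

(* Maps of Cantor space are written [f \; g] when composed from left to right,
   [f] being applied first. *)
(* Meaningful only if [f] is bijective. *)
Definition inverse n (f : cantor n -> cantor n) : cantor n -> cantor n :=
  'pinv_id [set: cantor n] f.

Definition homeomorphism n (f : cantor n -> cantor n) : Prop :=
  [/\ continuous f, bijective f & continuous (inverse f)].

Definition is_subgroup n (H : set (cantor n -> cantor n)) : Prop :=
  [/\ H `<=` @homeomorphism n,
      H id,
      forall f g, H f -> H g -> H (f \; g)
    & forall f, H f -> H (inverse f)].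

(* The subgroup of the homeomorphism group generated by a set of
   homeomorphisms; it is meaningful only if [A] consists of homeomorphisms. *)
Definition generated n (A : set (cantor n -> cantor n)) :=
  smallest (@is_subgroup n) A.

Definition conj_set n (A : set (cantor n -> cantor n))
    (g : cantor n -> cantor n) : set (cantor n -> cantor n) :=
  [set inverse g \; v \; g | v in A].

(* Words are indexed by ['I_l], so the [eta i] are pairwise incomparable,
   hence distinct, and the antichain has exactly [l] elements. *)
Definition max_antichain n l (eta : 'I_l -> word n) : Prop :=
  partition [set: 'I_l] (fun i => cone (eta i)) [set: cantor n].

Definition thompson n : set (cantor n -> cantor n) :=
  [set v | homeomorphism v /\
    exists (l : nat) (alpha beta : 'I_l -> word n),
      [/\ max_antichain alpha, max_antichain beta
        & forall i chi, v (wcat (alpha i) chi) = wcat (beta i) chi]].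

(* Finiteness of the state set is not part of the structure, so that the
   states of an inverse can be carved out of an infinite set of pairs. *)
Record transducer (n : nat) (Q : Type) := Transducer {
  trans : 'I_n -> Q -> Q;
  out : 'I_n -> Q -> word n }.

Fixpoint transw n Q (T : transducer n Q) (w : word n) (q : Q) : Q :=
  if w is x :: w' then transw T w' (trans T x q) else q.

Fixpoint outw n Q (T : transducer n Q) (w : word n) (q : Q) : word n :=
  if w is x :: w' then out T x q ++ outw T w' (trans T x q) else [::].

(* The map induced by the state [q]: letter [k] of the output is read off from
   the output on some prefix of [d] long enough to produce it; the choice of
   that prefix is immaterial.  The value is meaningful only if the output on
   [d] is infinite. *)
Definition run n Q (T : transducer n Q) (q : Q) (d : cantor n) : cantor n :=
  fun k =>
    let m := get [set m | k < size (outw T (mkseq d m) q)] in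
    nth (d 0 : 'I_n) (outw T (mkseq d m) q) k.

Definition infinite_output n Q (T : transducer n Q) : Prop :=
  forall (q : Q) (d : cantor n) (k : nat),
    exists m, k < size (outw T (mkseq d m) q).

Definition synchronous n Q (T : transducer n Q) : Prop :=
  forall x q, size (out T x q) = 1.

Definition accessible n Q (T : transducer n Q) (q0 : Q) : set Q :=
  [set q | exists w, transw T w q0 = q].

Lemma accessible_init n Q (T : transducer n Q) q0 : accessible T q0 q0.
Proof. by exists [::]. Qed.

Lemma accessible_trans n Q (T : transducer n Q) q0 x q :
  accessible T q0 q -> accessible T q0 (trans T x q).
Proof.
move=> [w <-]; exists (rcons w x).
by elim: w q0 => //= y w IH q0; rewrite IH.
Qed.

Definition accessible_part n Q (T : transducer n Q) (q0 : Q) :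
    transducer n {q : Q | accessible T q0 q} :=
  Transducer
    (fun x p => exist _ _ (accessible_trans x (proj2_sig p)))
    (fun x p => out T x (proj1_sig p)).

Definition prod_transducer n Q R (T : transducer n Q) (S : transducer n R) :
    transducer n (Q * R) :=
  Transducer
    (fun i p => (trans T i p.1, transw S (out T i p.1) p.2))
    (fun i p => outw S (out T i p.1) p.2).

Definition is_lcp n (A : set (cantor n)) (w : word n) : Prop :=
  (forall d, A d -> is_prefix w d) /\
  (forall u, (forall d, A d -> is_prefix u d) -> size u <= size w).

(* Meaningful only if [A] has at least two points. *)
Definition lcp n (A : set (cantor n)) : word n := xget [::] (is_lcp A).

Definition preim_lcp n Q (T : transducer n Q) (q : Q) (a : word n) : word n :=
  lcp (run T q @^-1` cone a).

Definition inverse_pairs n Q (T : transducer n Q) :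
    transducer n (word n * Q) :=
  Transducer
    (fun x p =>
       let u := rcons p.1 x in
       let v := preim_lcp T p.2 u in
       (drop (size (outw T v p.2)) u, transw T v p.2))
    (fun x p => preim_lcp T p.2 (rcons p.1 x)).

Definition inverse_state n Q (T : transducer n Q) (q0 : Q) : Type :=
  {p : word n * Q | accessible (inverse_pairs T) ([::], q0) p}.

Definition inverse_transducer n Q (T : transducer n Q) (q0 : Q) :
    transducer n (inverse_state T q0) :=
  accessible_part (inverse_pairs T) ([::], q0).

Definition synchronizing_at n Q (T : transducer n Q) (k : nat) : Prop :=
  exists f : k.-tuple 'I_n -> Q,
    forall (a : k.-tuple 'I_n) (q : Q), transw T a q = f a.

Definition synchronizing n Q (T : transducer n Q) : Prop :=
  exists k, synchronizing_at T k.

Definition one_way_synchronizing n Q (T : transducer n Q) (q0 : Q) : Prop :=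
  synchronizing T /\ ~ synchronizing (inverse_transducer T q0).

(* [viable] and [completion] are meant for a transducer all of whose states
   induce injective maps with clopen image. *)
Definition viable n Q (T : transducer n Q) l
    (rho : 'I_l -> word n) (p : 'I_l -> Q) : Prop :=
  let piece i := wcat (rho i) @` range (run T (p i)) in
  \bigcup_i piece i = [set: cantor n] /\
  (forall i j, i <> j -> piece i `&` piece j = set0).

Definition completion n Q (T : transducer n Q) : set (cantor n -> cantor n) :=
  [set h | homeomorphism h /\
    exists (l : nat) (rho : 'I_l -> word n) (p : 'I_l -> Q)
           (eta : 'I_l -> word n),
      [/\ viable T rho p, l = 1 %[mod n.-1], max_antichain eta
        & forall i chi,
            h (wcat (eta i) chi) = wcat (rho i) (run T (p i) chi)]].

Definition completion_group n Q (T : transducer n Q) :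
    set (cantor n -> cantor n) :=
  generated (completion T).

Definition state_group n Q (T : transducer n Q) : set (cantor n -> cantor n) :=
  generated (range (run T)).

Definition acts_below n (a : word n) (g h : cantor n -> cantor n) : Prop :=
  (forall chi, h (wcat a chi) = wcat a (g chi)) /\
  (forall d, ~ cone a d -> h d = d).

Definition thompson_ext n (G : set (cantor n -> cantor n)) :
    set (cantor n -> cantor n) :=
  generated (@thompson n `|`
    [set h | exists (a : word n) (g : cantor n -> cantor n),
       G g /\ acts_below a g h]).

(* Main.v *)
Require Import Defs.
From mathcomp Require Import all_boot.
From mathcomp Require Import all_classical topology.
From mathcomp Require Import zify.

(** Write [f] for the map of the initial state [q0] and [T_q] for the map of a
    state [q], so that [f (a c) = b (T_q c)] when reading the word [a] from
    [q0] outputs [b] and leads to [q].  The group to be described is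
    [f V f^-1], maps being composed from left to right.

    By compactness of Cantor space ([fan]), a homeomorphism belongs to
    Thompson's group if and only if near every point it replaces a prefix by
    another word ([thompsonP]).

    A state [(w, p)] of the inverse transducer sends [d] to the preimage of
    [w d] under [T_p] ([run_inverse_state]).  So a state [(q, (w, p))] of the
    product sends [c] to the point [z] with [T_p z = w (T_q c)].

    Every completion [h] of the product is in [f V f^-1]
    ([conj_thompson_of_tails]).  Indeed, reading the first [k] letters of a
    word, for [k] the synchronizing level, leads to a state that does not depend
    on where the reading starts.  Hence the points [T_q c] and [f (a c)] have a
    common tail, up to prefixes that are locally constant, and so have [T_p z]
    and [f (b z)].  As [T_p z = w (T_q c)], the map [f^-1 h f] replaces
    prefixes locally.

    Conversely, for [v] in [V], the map [h = f v f^-1] is itself a completion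
    ([conj_thompson_completion]).  For words [a] of a fixed large length, [v]
    maps [f (a c)] to [w (T_q c)] for some word [w], and [h (a c)] is the image
    of [w (T_q c)] under the initial state of the inverse.  That state outputs
    a word [b] on reading [w] and moves to a state [s], so that
    [h (a c) = b (c')] with [c'] the image of [c] under [(q, s)].  There are
    [n ^ m] words of length [m], and this number is [1] modulo [n - 1].

    If [T] is synchronous, its states induce permutations of the words of each
    length.  Therefore all [T_q] are homeomorphisms, the states of the inverse
    have an empty word component, and [(q, (w, p))] induces [T_q T_p^-1].  A
    completion is then a product of maps that act by such homeomorphisms below
    the words of an antichain, followed by an element of [V]
    ([completion_thompson_ext]).  Conversely [V] and the maps acting by
    generators below a word are locally of the form required in
    [conj_thompson_of_tails]. *)

Set Implicit Arguments.
Unset Strict Implicit.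
Unset Printing Implicit Defensive.

Local Open Scope classical_set_scope.

(** * Words and infinite words *)

(** The tail of [d] after its first [m] letters. *)
Definition dropc n m (d : cantor n) : cantor n := fun k => d (m + k).

Lemma wcat0 n (d : cantor n) : wcat [::] d = d.
Proof. by apply/funext => k; rewrite /wcat nth_nil subn0. Qed.

Lemma wcat_cat n (a b : word n) d : wcat (a ++ b) d = wcat a (wcat b d).
Proof.
apply/funext => k; rewrite /wcat nth_cat; case: ltnP => ka.
  exact: set_nth_default.
by rewrite [RHS]nth_default // size_cat subnDA.
Qed.

Lemma wcatE_lt n (a : word n) (d : cantor n) x0 k :
  k < size a -> wcat a d k = nth x0 a k.
Proof. by move=> ka; exact: set_nth_default. Qed.

Lemma wcatE_ge n (a : word n) (d : cantor n) k : wcat a d (size a + k) = d k.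
Proof. by rewrite /wcat nth_default ?leq_addr // addKn. Qed.

Lemma mkseq_wcat n (a : word n) d m :
  mkseq (wcat a d) (size a + m) = a ++ mkseq d m.
Proof.
case: n a d => [a d|n a d]; first by case: (d 0).
apply: (@eq_from_nth _ ord0); first by rewrite size_cat !size_mkseq.
move=> k; rewrite size_mkseq => km; rewrite nth_mkseq // nth_cat.
case: ltnP => ka; first exact: set_nth_default.
by rewrite nth_mkseq 1?ltn_subLR // -{1}(subnKC ka) wcatE_ge.
Qed.

Lemma is_prefix_wcat n (a : word n) d : is_prefix a (wcat a d).
Proof. by rewrite /is_prefix -[X in mkseq _ X]addn0 mkseq_wcat cats0. Qed.

Lemma mkseqD n (d : cantor n) m k :
  mkseq d (m + k) = mkseq d m ++ mkseq (dropc m d) k.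
Proof.
rewrite /mkseq iotaD map_cat add0n; congr (_ ++ _).
by rewrite -[in iota m k](addn0 m) iotaDl -map_comp; apply: eq_map.
Qed.

Lemma wcat_mkseq n (d : cantor n) m : wcat (mkseq d m) (dropc m d) = d.
Proof.
apply/funext => k; case: (ltnP k m) => km.
  by rewrite (wcatE_lt _ (d 0)) ?nth_mkseq // size_mkseq.
have := wcatE_ge (mkseq d m) (dropc m d) (k - m).
by rewrite size_mkseq /dropc subnKC.
Qed.

Lemma is_prefixE n (a : word n) d :
  is_prefix a d -> d = wcat a (dropc (size a) d).
Proof. by move=> ad; rewrite -{1}(wcat_mkseq d (size a)) ad. Qed.

Lemma is_prefix_mkseq n (d : cantor n) m : is_prefix (mkseq d m) d.
Proof. by rewrite /is_prefix size_mkseq. Qed.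

Lemma is_prefix_catl n (a b : word n) d : is_prefix (a ++ b) d -> is_prefix a d.
Proof. by move/is_prefixE ->; rewrite wcat_cat; exact: is_prefix_wcat. Qed.

Lemma dropc_wcat n (a : word n) d : dropc (size a) (wcat a d) = d.
Proof. by apply/funext => k; rewrite /dropc wcatE_ge. Qed.

Lemma wcat_inj n (a : word n) : injective (@wcat n a).
Proof. by move=> d e de; rewrite -(dropc_wcat a d) de dropc_wcat. Qed.

(** Two words that are prefixes of the same point are comparable. *)
Lemma wcat_split n (a b : word n) d e :
  wcat a d = wcat b e -> size a <= size b ->
  b = a ++ drop (size a) b /\ d = wcat (drop (size a) b) e.
Proof.
move=> E ab.
have bE : b = a ++ drop (size a) b.
  have := is_prefix_wcat b e; rewrite -E /is_prefix.
  rewrite -{1}(subnKC ab) mkseq_wcat => bE.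
  by rewrite -{2}bE drop_size_cat.
by split=> //; apply: (@wcat_inj _ a); rewrite -wcat_cat -bE.
Qed.

Lemma wcat_eqsize n (a b : word n) d e :
  wcat a d = wcat b e -> size a = size b -> a = b /\ d = e.
Proof.
move=> E ab; have [] := wcat_split E (eq_leq ab).
by rewrite ab drop_size cats0 wcat0.
Qed.

Lemma is_prefix_comparable n (a b : word n) d :
  is_prefix a d -> is_prefix b d -> size a <= size b ->
  b = a ++ drop (size a) b.
Proof.
by move=> /is_prefixE da /is_prefixE db ab; have [] := wcat_split (etrans (esym da) db) ab.
Qed.

Lemma mkseq_le n (d e : cantor n) m k :
  k <= m -> mkseq d m = mkseq e m -> mkseq d k = mkseq e k.
Proof.
move=> km E; have := congr1 (take k) E.
by rewrite -(subnKC km) !mkseqD !take_size_cat ?size_mkseq.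
Qed.

Lemma mkseq_wcat_le n (a : word n) d e m :
  mkseq d m = mkseq e m -> mkseq (wcat a d) m = mkseq (wcat a e) m.
Proof.
move=> E; apply: (@mkseq_le _ _ _ (size a + m)); first exact: leq_addl.
by rewrite !mkseq_wcat E.
Qed.

Lemma cantor_eq n (d e : cantor n) : (forall m, mkseq d m = mkseq e m) -> d = e.
Proof.
move=> E; apply/funext => k; have := congr1 (fun s => nth (d 0) s k) (E k.+1).
by rewrite !nth_mkseq.
Qed.

(** A property of words that is inherited by extensions and holds at some
    prefix of every point holds for all words of some fixed length (compactness
    of Cantor space).  Otherwise, bad words, those having arbitrarily long
    extensions without the property, could be extended letter by letter to a
    point without good prefix. *)
Lemma fan n (P : word n -> Prop) :
  (forall u v, P u -> P (u ++ v)) ->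
  (forall d : cantor n, exists m, P (mkseq d m)) ->
  exists m, forall u, size u = m -> P u.
Proof.
move=> Pmon Pbar; pose bad u := forall m, exists2 w, size w = m & ~ P (u ++ w).
apply: contrapT => NP.
have bad0 : bad [::].
  move=> m; apply: contrapT => Nm; apply: NP; exists m => u um.
  by apply: contrapT => Pu; apply: Nm; exists u.
have badS u : exists x, bad u -> bad (rcons u x).
  have [bu|nbu] := pselect (bad u); last first.
    have [w] := bad0 1; case: w => // x w _ _; by exists x.
  apply: contrapT => /forallNP H.
  have H1 x : exists m, forall w, size w = m -> P (rcons u x ++ w).
    have /not_implyP[_ /existsNP[m Hm]] := H x; exists m => w wm.
    by apply: contrapT => Pw; apply: Hm; exists w.
  have [M HM] := choice H1.
  (* An extension longer than all the [M x] contradicts the bound of its first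
     letter. *)
  have [w wS] := bu (\max_x M x).+1; apply.
  case: w wS => // x w [wS].
  rewrite -cat_rcons -(cat_take_drop (M x) w) catA; apply/Pmon/HM.
  by rewrite size_takel // wS leq_bigmax.
have [nx Hnx] := choice badS.
pose U k := iter k (fun u => rcons u (nx u)) [::].
have badU k : bad (U k) by elim: k => //= k IH; apply: Hnx.
pose d : cantor n := fun k => nx (U k).
have UE k : mkseq d k = U k by elim: k => //= k IH; rewrite mkseqS IH.
have [m] := Pbar d; rewrite UE => PU.
by have [w _] := badU m 0; apply; apply: Pmon.
Qed.

(** * Topology of Cantor space through prefixes *)

(** The sets of points sharing a prefix of given length with [d] form a basis
    of neighborhoods of [d]. *)
Lemma nbhs_cantorP n (d : cantor n) (A : set (cantor n)) :
  nbhs d A <-> exists m, forall e : cantor n, mkseq e m = mkseq d m -> A e.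
Proof.
split; last first.
  move=> [m Hm]; elim: m A Hm => [|m IH] A Hm.
    by apply: filterS filterT => e _; exact: Hm.
  have : nbhs d ([set e : cantor n | mkseq e m = mkseq d m] `&`
                 [set e : cantor n | e m = d m]).
    apply: filterI; first exact: IH.
    apply: (@proj_continuous nat (fun _ => discrete_topology 'I_n) m d [set d m]).
    by rewrite nbhs_principalE.
  by apply: filterS => e [/= em eE]; apply: Hm; rewrite !mkseqS em eE.
pose B m := [set e : cantor n | mkseq e m = mkseq d m].
pose F := filter_from [set: nat] B.
have FF : Filter F.
  apply: filter_from_filter; first by exists 0.
  move=> i j _ _; exists (maxn i j) => // e /= E.
  by split; [apply: mkseq_le E; rewrite leq_maxl | apply: mkseq_le E; rewrite leq_maxr].
(* The filter [F] of these sets converges to [d] in every coordinate, so it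
   refines the neighborhood filter. *)
have : F --> d.
  apply/cvg_sup => i C [U [[V oV <-] Vd UC]].
  exists i.+1 => // e; rewrite /B /= !mkseqS => /eqP; rewrite eqseq_rcons => /andP[_ /eqP E].
  by apply: UC; rewrite /= E.
by move=> /(_ A) H /H [m _ Hm]; exists m => e; exact: Hm.
Qed.

Lemma continuous_cantorP n (g : cantor n -> cantor n) :
  continuous g <-> forall d k, exists m, forall e : cantor n,
    mkseq e m = mkseq d m -> mkseq (g e) k = mkseq (g d) k.
Proof.
split=> [gc d k|H d A].
  have /gc : nbhs (g d) [set e : cantor n | mkseq e k = mkseq (g d) k].
    by apply/nbhs_cantorP; exists k.
  by move/nbhs_cantorP.
move=> /nbhs_cantorP[k Hk]; apply/nbhs_cantorP.
by have [m Hm] := H d k; exists m => e /Hm/Hk.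
Qed.

(** * Groups of homeomorphisms *)

Section Inverse.
Variables (n : nat) (f : cantor n -> cantor n).
Hypothesis f_bij : bijective f.

Lemma inverseK : cancel f (inverse f).
Proof.
have [g fK _] := f_bij; move=> d.
by rewrite /inverse pinvKV ?inE //; apply: in2W; exact: can_inj fK.
Qed.

Lemma inverseVK : cancel (inverse f) f.
Proof. by have [g fK gK] := f_bij; move=> d; rewrite -(gK d) inverseK. Qed.

Lemma inverse_uniq g : cancel g f -> inverse f = g.
Proof. by move=> gK; apply/funext => d; rewrite -{1}(gK d) inverseK. Qed.

End Inverse.

Lemma homeomorphismI n (f g : cantor n -> cantor n) :
  continuous f -> continuous g -> cancel f g -> cancel g f -> homeomorphism f.
Proof.
by move=> fc gc fK gK; split=> //; [exists g | rewrite (inverse_uniq _ gK) //; exists g].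
Qed.

Lemma homeomorphism_bij n (f : cantor n -> cantor n) : homeomorphism f -> bijective f.
Proof. by case. Qed.

Lemma homeomorphism_inj n (f : cantor n -> cantor n) : homeomorphism f -> injective f.
Proof. by move=> fh; apply: bij_inj; exact: homeomorphism_bij. Qed.

Lemma continuous_catcomp n (f g : cantor n -> cantor n) :
  continuous f -> continuous g -> continuous (f \; g).
Proof. by move=> fc gc d; apply: continuous_comp; [exact: fc | exact: gc]. Qed.

Lemma homeomorphism_id n : homeomorphism (@id (cantor n)).
Proof. by apply: (@homeomorphismI _ _ id) => // d; exact: cvg_id. Qed.

Lemma homeomorphism_comp n (f g : cantor n -> cantor n) :
  homeomorphism f -> homeomorphism g -> homeomorphism (f \; g).
Proof.
move=> [fc fb fic] [gc gb gic].
apply: (@homeomorphismI _ _ (inverse g \; inverse f)); try exact: continuous_catcomp.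
  by move=> d /=; rewrite !inverseK.
by move=> d /=; rewrite !inverseVK.
Qed.

Lemma homeomorphism_inverse n (f : cantor n -> cantor n) :
  homeomorphism f -> homeomorphism (inverse f).
Proof.
move=> [fc fb fic]; apply: (@homeomorphismI _ _ f) => //.
  exact: inverseVK.
exact: inverseK.
Qed.

Lemma inverse_inverse n (f : cantor n -> cantor n) :
  bijective f -> inverse (inverse f) = f.
Proof.
move=> fb; apply: inverse_uniq; last exact: inverseK.
by exists f; [exact: inverseVK | exact: inverseK].
Qed.

(** * Local prefix replacements *)

(** The map [h] is, near every point, the replacement of a prefix by a word. *)
Definition locally_prefix n (h : cantor n -> cantor n) : Prop :=
  forall d, exists u v, is_prefix u d /\ forall e, h (wcat u e) = wcat v e.

Lemma locally_prefix_comp n (g h : cantor n -> cantor n) :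
  locally_prefix g -> locally_prefix h -> locally_prefix (g \; h).
Proof.
move=> gl hl d; have [u [v [ud guv]]] := gl d; have [u' [v' [ud' hu']]] := hl (g d).
set e := dropc (size u) d; pose w := mkseq e (size u').
have dE : d = wcat (u ++ w) (dropc (size u') e).
  by rewrite wcat_cat wcat_mkseq -is_prefixE.
(* Appending [w] to [u] makes the image of the prefix longer than [u']. *)
exists (u ++ w), (v' ++ drop (size u') (v ++ w)); split.
  by rewrite dE; exact: is_prefix_wcat.
pose r := drop (size u') (v ++ w).
have vu' : v ++ w = u' ++ r.
  apply: (is_prefix_comparable ud'); last by rewrite size_cat size_mkseq leq_addl.
  by rewrite dE wcat_cat guv -wcat_cat; exact: is_prefix_wcat.
by move=> c; rewrite /= -/r wcat_cat guv -wcat_cat vu' !wcat_cat hu'.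
Qed.

Lemma locally_prefix_inverse n (h : cantor n -> cantor n) :
  bijective h -> locally_prefix h -> locally_prefix (inverse h).
Proof.
move=> hb hl d; have [u [v [/is_prefixE ud huv]]] := hl (inverse h d).
exists v, u; split; last by move=> e; rewrite -huv inverseK.
by rewrite -(inverseVK hb d) ud huv; exact: is_prefix_wcat.
Qed.

Lemma antichain_cover n l (eta : 'I_l -> word n) :
  max_antichain eta -> forall d, exists i, is_prefix (eta i) d.
Proof.
move=> [eP _ _] d; have : [set: cantor n] d by [].
by rewrite -eP => -[i _ di]; exists i.
Qed.

(** The words of length [m], enumerated. *)
Definition level n m (i : 'I_#|{: m.-tuple 'I_n}|) : word n := val (enum_val i).

Lemma size_level n m (i : 'I_#|{: m.-tuple 'I_n}|) : size (level i) = m.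
Proof. exact: size_tuple. Qed.

Lemma level_antichain n m : 0 < n -> max_antichain (@level n m).
Proof.
move=> n0; split.
- apply/seteqP; split=> // d _.
  exists (enum_rank (mktuple (fun i : 'I_m => d i))) => //.
  rewrite /cone /= /is_prefix size_level /level enum_rankK.
  by rewrite /mkseq -val_enum_ord -map_comp.
- move=> i j _ _ [d [/= di dj]]; apply/enum_val_inj/val_inj.
  by rewrite /= -[tval _]di -[RHS]dj !size_level.
- by move=> i _; exists (wcat (level i) (fun=> Ordinal n0)); exact: is_prefix_wcat.
Qed.

Lemma card_level_mod n m : 0 < n -> #|{: m.-tuple 'I_n}| = 1 %[mod n.-1].
Proof.
case: n => // n _; rewrite card_tuple card_ord /= -modnXm.
by rewrite -[in X in X %% n]addn1 modnDl modnXm exp1n.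
Qed.

Lemma thompsonP n (h : cantor n -> cantor n) : 0 < n ->
  thompson h <-> homeomorphism h /\ locally_prefix h.
Proof.
move=> n0; split=> [[hh [l [a [b [aP bP ab]]]]]|[hh hl]]; split=> //.
  by move=> d; have [i di] := antichain_cover aP d; exists (a i), (b i).
(* By compactness [h] replaces all prefixes of some length [m]; the words that
   replace them form an antichain as [h] is a bijection. *)
pose P (u : word n) := exists v, forall e, h (wcat u e) = wcat v e.
have [m Hm] : exists m, forall u, size u = m -> P u.
  apply: fan => [u v [v' uv]|d].
    by exists (v' ++ v) => e; rewrite !wcat_cat uv.
  have [u [v [ud uv]]] := hl d; exists (size u); exists v => e.
  by rewrite ud.
have [b Hb] := choice (fun i => Hm _ (@size_level n m i)).
exists _, (@level n m), b; split=> //; first exact: level_antichain.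
have aP := level_antichain m n0; have [_ aP2 _] := aP.
have coneb i d : cone (b i) (h d) -> cone (level i) d.
  move=> /is_prefixE; rewrite -Hb => /(homeomorphism_inj hh) ->.
  exact: is_prefix_wcat.
split.
- apply/seteqP; split=> // d _.
  have [i di] := antichain_cover aP (inverse h d); exists i => //.
  rewrite -(inverseVK (homeomorphism_bij hh) d) (is_prefixE di) Hb.
  exact: is_prefix_wcat.
- move=> i j _ _ [d]; rewrite -(inverseVK (homeomorphism_bij hh) d) => -[di dj].
  by apply: aP2 => //; exists (inverse h d); split; exact: coneb.
- by move=> i _; exists (wcat (b i) (fun=> Ordinal n0)); exact: is_prefix_wcat.
Qed.

Lemma conj_thompsonP n (f h : cantor n -> cantor n) : 0 < n -> homeomorphism f ->
  conj_set (@thompson n) (inverse f) h <->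
    homeomorphism h /\ locally_prefix (inverse f \; h \; f).
Proof.
move=> n0 fh; have fb := homeomorphism_bij fh; rewrite /conj_set inverse_inverse //.
have ih := homeomorphism_inverse fh.
split=> [[v /(thompsonP _ n0)[vh vl] <-]|[hh hl]].
  split; first by do 2!(apply: homeomorphism_comp => //).
  suff -> : inverse f \; (f \; v \; inverse f) \; f = v by [].
  by apply/funext => d /=; rewrite !inverseVK.
exists (inverse f \; h \; f).
  by apply/(thompsonP _ n0); split=> //; do 2!(apply: homeomorphism_comp => //).
by apply/funext => d /=; rewrite !inverseK.
Qed.

Lemma conj_thompson_subgroup n (f : cantor n -> cantor n) : 0 < n ->
  homeomorphism f -> is_subgroup (conj_set (@thompson n) (inverse f)).
Proof.
move=> n0 fh; have fb := homeomorphism_bij fh; have ih := homeomorphism_inverse fh.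
have conjP h := conj_thompsonP h n0 fh.
split.
- by move=> h /conjP[].
- apply/conjP; split; first exact: homeomorphism_id.
  by move=> d; exists [::], [::]; split=> // e; rewrite /= inverseVK.
- move=> g h /conjP[gh gl] /conjP[hh hl]; apply/conjP; split.
    exact: homeomorphism_comp.
  have -> : inverse f \; (g \; h) \; f =
            (inverse f \; g \; f) \; (inverse f \; h \; f).
    by apply/funext => d /=; rewrite inverseK.
  exact: locally_prefix_comp.
- move=> h /conjP[hh hl]; have hb := homeomorphism_bij hh; apply/conjP; split.
    exact: homeomorphism_inverse.
  have <- : inverse (inverse f \; h \; f) = inverse f \; inverse h \; f.
    apply: inverse_uniq; last by move=> d /=; rewrite inverseK // inverseVK // inverseVK.
    by apply: homeomorphism_bij; do 2!(apply: homeomorphism_comp => //).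
  apply: locally_prefix_inverse => //.
  by apply: homeomorphism_bij; do 2!(apply: homeomorphism_comp => //).
Qed.

(** * Runs of transducers *)

Lemma nth_prefix n (a : word n) d x0 k :
  is_prefix a d -> k < size a -> nth x0 a k = d k.
Proof. by move=> ad ka; rewrite -ad nth_mkseq. Qed.

Lemma is_prefixP n (a : word n) d :
  (forall x0 k, k < size a -> nth x0 a k = d k) -> is_prefix a d.
Proof.
move=> H; apply: (@eq_from_nth _ (d 0)); rewrite size_mkseq // => k ka.
by rewrite nth_mkseq // H.
Qed.

Lemma is_prefix_catr n (a b : word n) d :
  is_prefix b d -> is_prefix (a ++ b) (wcat a d).
Proof. by rewrite /is_prefix size_cat mkseq_wcat => ->. Qed.

Lemma is_prefix_cat n (a b : word n) d :
  is_prefix (a ++ b) (wcat a d) -> is_prefix b d.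
Proof.
by move/is_prefixE; rewrite wcat_cat => /wcat_inj ->; exact: is_prefix_wcat.
Qed.

Section Run.
Variables (n : nat) (Q : Type) (T : transducer n Q).

Lemma transw_cat a b q : transw T (a ++ b) q = transw T b (transw T a q).
Proof. by elim: a q => //= x a IH q. Qed.

Lemma outw_cat a b q : outw T (a ++ b) q = outw T a q ++ outw T b (transw T a q).
Proof. by elim: a q => //= x a IH q; rewrite IH catA. Qed.

(** Any prefix of [d] whose output is longer than [k] determines the letter
    [k] of the output on [d]. *)
Lemma run_nth q d x0 k m : k < size (outw T (mkseq d m) q) ->
  run T q d k = nth x0 (outw T (mkseq d m) q) k.
Proof.
move=> km; rewrite /run; set m' := get _.
have km' : k < size (outw T (mkseq d m') q).
  by apply: (@getPex _ [set m | k < size (outw T (mkseq d m) q)]); exists m.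
rewrite (set_nth_default x0) //; clearbody m'.
have [mm'|/ltnW mm'] := leqP m m'.
  by rewrite -(subnKC mm') mkseqD outw_cat nth_cat km.
by rewrite -(subnKC mm') mkseqD outw_cat nth_cat km'.
Qed.

Lemma run_prefix q d m : is_prefix (outw T (mkseq d m) q) (run T q d).
Proof. by apply: is_prefixP => x0 k km; rewrite (run_nth x0 km). Qed.

Lemma run_uniq q d e :
  (forall k, exists2 m, k < size (outw T (mkseq d m) q)
                      & is_prefix (outw T (mkseq d m) q) e) ->
  run T q d = e.
Proof.
move=> H; apply/funext => k; have [m km mp] := H k.
by rewrite (run_nth (d 0) km) (nth_prefix _ mp).
Qed.

Hypothesis T_inf : infinite_output T.

Lemma run_wcat q a d :
  run T q (wcat a d) = wcat (outw T a q) (run T (transw T a q) d).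
Proof.
apply: run_uniq => k; have [m km] := T_inf (transw T a q) d k.
exists (size a + m); rewrite mkseq_wcat outw_cat.
  by rewrite size_cat (leq_trans km) // leq_addl.
exact/is_prefix_catr/run_prefix.
Qed.

Lemma run_continuous q : continuous (run T q).
Proof.
apply/continuous_cantorP => d k; have [m km] := T_inf q d k.
exists m => e em; apply: mkseq_le (ltnW km) _.
by have := run_prefix q d m; have := run_prefix q e m; rewrite /is_prefix em => -> ->.
Qed.

End Run.

Section Product.
Variables (n : nat) (Q R : Type) (T : transducer n Q) (S : transducer n R).
Hypothesis T_inf : infinite_output T.
Hypothesis S_inf : infinite_output S.

Lemma outw_prod u q s :
  outw (prod_transducer T S) u (q, s) = outw S (outw T u q) s.
Proof. by elim: u q s => //= x u IH q s; rewrite IH outw_cat. Qed.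

Lemma run_prod q s d : run (prod_transducer T S) (q, s) d = run S s (run T q d).
Proof.
apply: run_uniq => k; have [M kM] := S_inf s (run T q d) k.
have [m Mm] := T_inf q d M; exists m; rewrite outw_prod; have := run_prefix T q d m.
  rewrite /is_prefix => <-; rewrite -(subnKC (ltnW Mm)) mkseqD outw_cat size_cat.
  by rewrite (leq_trans kM) // leq_addr.
by rewrite /is_prefix => {1 2}<-; exact: run_prefix.
Qed.

End Product.

Lemma wcat_continuous n (a : word n) : continuous (@wcat n a).
Proof.
by apply/continuous_cantorP => d k; exists k => e; exact: mkseq_wcat_le.
Qed.

Lemma dropc_continuous n m : continuous (@dropc n m).
Proof.
apply/continuous_cantorP => d k; exists (m + k) => e.
by rewrite !mkseqD => /eqP; rewrite eqseq_cat ?size_mkseq // => /andP[_ /eqP].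
Qed.

(** * Longest common prefixes *)

Lemma lcp_uniq n (A : set (cantor n)) w : A !=set0 -> is_lcp A w -> lcp A = w.
Proof.
move=> [d Ad] Aw; have [Al1 Al2] : is_lcp A (lcp A) by apply: xgetPex; exists w.
have [Aw1 Aw2] := Aw.
have sz : size (lcp A) = size w.
  by apply/eqP; rewrite eqn_leq Aw2 //= Al2.
by have [] := wcat_eqsize (etrans (esym (is_prefixE (Al1 _ Ad))) (is_prefixE (Aw1 _ Ad))) sz.
Qed.

Lemma lcpP n (A : set (cantor n)) d e : A d -> A e -> d <> e -> is_lcp A (lcp A).
Proof.
move=> Ad Ae de; apply: xgetPex.
pose P k := `[< forall c, A c -> is_prefix (mkseq d k) c >].
have [K KE] : exists K, mkseq d K <> mkseq e K.
  by apply: contrapT => /forallNP H; apply: de; apply: cantor_eq => m; exact: contrapT.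
have P0 : exists k, P k by exists 0; apply/asboolP.
have PK k : P k -> k <= K.
  move/asboolP => /(_ e Ae); rewrite /is_prefix size_mkseq => E.
  by case: leqP => // /ltnW kK; case: KE; exact: mkseq_le kK (esym E).
case: (ex_maxnP P0 PK) => k /asboolP Pk kmax; exists (mkseq d k); split=> // u Hu.
rewrite size_mkseq; apply: kmax; apply/asboolP => c Ac.
by rewrite (Hu d Ad); exact: Hu.
Qed.

Lemma is_lcp_wcat n (B : set (cantor n)) v w :
  B !=set0 -> is_lcp B w -> is_lcp (wcat v @` B) (v ++ w).
Proof.
move=> [d Bd] [Bw1 Bw2]; split=> [_ [e Be <-]|u Hu].
  exact/is_prefix_catr/Bw1.
have [uv|/ltnW vu] := leqP (size u) (size v).
  by rewrite size_cat (leq_trans uv) // leq_addr.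
have uE : u = v ++ drop (size v) u.
  apply: (is_prefix_comparable (is_prefix_wcat v d)) => //.
  by apply: Hu; exists d.
rewrite uE !size_cat leq_add2l; apply: Bw2 => e Be; apply: (@is_prefix_cat _ v).
by rewrite -uE; apply: Hu; exists e.
Qed.

(** * The states of the inverse transducer *)

Lemma cone_points n (a : word n) : 2 <= n ->
  exists d e : cantor n, [/\ cone a d, cone a e & d (size a) <> e (size a)].
Proof.
move=> n2; have n0 : 0 < n by exact: ltnW.
exists (wcat a (fun=> Ordinal n0)), (wcat a (fun=> Ordinal n2)).
split; try exact: is_prefix_wcat.
by rewrite -[size a]addn0 !wcatE_ge => /(congr1 val).
Qed.

Lemma cone_is_lcp n (a : word n) : 2 <= n -> is_lcp (cone a) a.
Proof.
move=> n2; split=> // u Hu; have [d [e [da ea de]]] := cone_points a n2.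
rewrite leqNgt; apply/negP => au; apply: de.
by rewrite -(nth_prefix (d 0) (Hu d da) au) (nth_prefix _ (Hu e ea) au).
Qed.

Section Inverse_transducer.
Variables (n : nat) (Q : Type) (T : transducer n Q) (q0 : Q).
Hypothesis n_ge2 : 2 <= n.
Hypothesis T_inf : infinite_output T.
Hypothesis T_acc : forall q : Q, accessible T q0 q.
Hypothesis T_homeo : homeomorphism (run T q0).

Let f := run T q0.
Let f_bij : bijective f := homeomorphism_bij T_homeo.

(** If the word [a] leads from [q0] to [q] with output [b], then
    [d |-> f^-1 (b d)] with its first [size a] letters erased is a left inverse
    of [T_q]. *)
Lemma run_state_retract q :
  exists2 g : cantor n -> cantor n, continuous g & cancel (run T q) g.
Proof.
have [a <-] := T_acc q.
exists (@wcat n (outw T a q0) \; inverse f \; @dropc n (size a)).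
  have [_ _ fic] := T_homeo.
  by do 2!(apply: continuous_catcomp => //; first try exact: wcat_continuous);
     exact: dropc_continuous.
by move=> d /=; rewrite -run_wcat // inverseK // dropc_wcat.
Qed.

Lemma run_state_inj q : injective (run T q).
Proof. by have [g _ /can_inj] := run_state_retract q. Qed.

(** The pairs [(w, q)] such that all points of the cone of [w] have a preimage
    under [T_q] and these preimages have no nonempty common prefix; all states
    of the inverse transducer are of this kind. *)
Definition inverse_pair (p : word n * Q) : Prop :=
  cone p.1 `<=` range (run T p.2) /\ preim_lcp T p.2 p.1 = [::].

Lemma preim_lcpP q a : cone a `<=` range (run T q) ->
  is_lcp (run T q @^-1` cone a) (preim_lcp T q a).
Proof.
move=> aq; have [d [e [da ea de]]] := cone_points a n_ge2.
have [x _ xd] := aq d da; have [y _ ye] := aq e ea.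
apply: (@lcpP _ _ x y); rewrite /= ?xd ?ye // => xy.
by apply: de; rewrite -xd -ye xy.
Qed.

(** The transition of the inverse transducer at [(w, q)] on the letter [x]:
    its output [v], the longest common prefix of the preimages of the cone of
    [w x], is such that the output of [v] from [q] is a prefix of [w x]; the
    rest [w'] and the state [q'] reached by [v] form the next state, and the
    preimages of the cone of [w x u] under [T_q] are those of the cone of
    [w' u] under [T_q'] with [v] put in front. *)
Lemma preim_lcp_step w q x (v := preim_lcp T q (rcons w x))
    (w' := drop (size (outw T v q)) (rcons w x)) (q' := transw T v q) :
  cone w `<=` range (run T q) ->
  [/\ rcons w x = outw T v q ++ w',
      inverse_pair (w', q')
    & forall u, preim_lcp T q (rcons w x ++ u) = v ++ preim_lcp T q' (w' ++ u)].
Proof.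
move=> wq.
have wxq : cone (rcons w x) `<=` range (run T q).
  by move=> d; rewrite /cone /= -cats1 => /is_prefix_catl; exact: wq.
have [vpre _] := preim_lcpP wxq; rewrite -/v in vpre.
have wxE : rcons w x = outw T v q ++ w'.
  (* The output of [v] is a prefix of all points of the cone of [w x], hence of
     their longest common prefix, which is [w x]. *)
  have pre d : cone (rcons w x) d -> is_prefix (outw T v q) d.
    move=> dwx; have [c _ cd] := wxq d dwx; rewrite -cd.
    rewrite (is_prefixE (vpre c _)) /= ?cd // run_wcat //; exact: is_prefix_wcat.
  have [_ /(_ _ pre) sz] := cone_is_lcp (rcons w x) n_ge2.
  have [d [_ [dwx _ _]]] := cone_points (rcons w x) n_ge2.
  exact: is_prefix_comparable (pre d dwx) dwx sz.
have preE u : run T q @^-1` cone (rcons w x ++ u) =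
    wcat v @` (run T q' @^-1` cone (w' ++ u)).
  apply/seteqP; split=> [d /= du|_ [d /= du <-]].
    have dv : d = wcat v (dropc (size v) d).
      by apply/is_prefixE/vpre; exact: is_prefix_catl du.
    exists (dropc (size v) d) => //=; apply: (@is_prefix_cat _ (outw T v q)).
    by rewrite catA -wxE -run_wcat // -dv.
  by rewrite wxE -catA /cone /= run_wcat //; exact: is_prefix_catr.
have wq' : cone w' `<=` range (run T q').
  move=> d dw'; have [|c _ cd] := wxq (wcat (outw T v q) d).
    by rewrite wxE; exact: is_prefix_catr.
  have cv : c = wcat v (dropc (size v) c).
    by apply/is_prefixE/vpre; rewrite /= cd wxE; exact: is_prefix_catr.
  exists (dropc (size v) c) => //; apply: (@wcat_inj _ (outw T v q)).
  by rewrite -run_wcat // -cv.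
have stepE u : preim_lcp T q (rcons w x ++ u) = v ++ preim_lcp T q' (w' ++ u).
  have wuq' : cone (w' ++ u) `<=` range (run T q').
    by move=> d /is_prefix_catl; exact: wq'.
  have [d [_ [dw _ _]]] := cone_points (w' ++ u) n_ge2.
  have [c _ cd] := wuq' d dw.
  rewrite /preim_lcp preE; apply: lcp_uniq.
    by exists (wcat v c), c; rewrite //= cd.
  by apply: is_lcp_wcat; [exists c; rewrite /= cd | exact: preim_lcpP].
split=> //; split=> //=; have := stepE [::]; rewrite !cats0 -/v => /(congr1 size).
by rewrite size_cat => /eqP; rewrite -{1}[size v]addn0 eqn_add2l eq_sym => /nilP.
Qed.

Lemma outw_inverse_pairs u p : inverse_pair p ->
  outw (inverse_pairs T) u p = preim_lcp T p.2 (p.1 ++ u).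
Proof.
elim: u p => [|x u IH] [w q] [wq wl]; first by rewrite cats0.
have [_ p' E] := preim_lcp_step x wq.
by rewrite -cat_rcons E /=; congr (_ ++ _); exact: IH p'.
Qed.

Lemma inverse_pair_transw u p :
  inverse_pair p -> inverse_pair (transw (inverse_pairs T) u p).
Proof.
elim: u p => [|x u IH] [w q] // [wq _]; apply: IH.
by have [] := preim_lcp_step x wq.
Qed.

Lemma inverse_pair_init : inverse_pair ([::], q0).
Proof.
split=> [d _|] /=; first by exists (inverse f d) => //; exact: inverseVK.
have [d [_ [d0 _ _]]] := @cone_points n [::] n_ge2.
apply: lcp_uniq; first by exists d.
suff -> : run T q0 @^-1` cone [::] = cone [::] by exact: cone_is_lcp.
by apply/seteqP.
Qed.

Let S := inverse_transducer T q0.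

Lemma inverse_state_pair (s : inverse_state T q0) : inverse_pair (proj1_sig s).
Proof. by case: s => p pu; case: (pu) => u /= <-; exact/inverse_pair_transw/inverse_pair_init. Qed.

Lemma outw_inverse_transducer u (s : inverse_state T q0) :
  outw S u s = preim_lcp T (proj1_sig s).2 ((proj1_sig s).1 ++ u).
Proof.
rewrite -outw_inverse_pairs; last exact: inverse_state_pair.
by elim: u s => //= x u IH s; rewrite IH.
Qed.

(** The outputs of the inverse transducer are longest common prefixes of
    preimages of shrinking cones; their lengths are unbounded because the left
    inverses of the maps [T_q] are continuous. *)
Lemma inverse_transducer_infinite : infinite_output S.
Proof.
move=> s d k; have [wq _] := inverse_state_pair s.
set w := (proj1_sig s).1 in wq; set q := (proj1_sig s).2 in wq.
have [g /continuous_cantorP gc gK] := run_state_retract q.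
have [m Hm] := gc (wcat w d) k.+1.
exists m; rewrite outw_inverse_transducer -/w -/q.
have wmq : cone (w ++ mkseq d m) `<=` range (run T q).
  by move=> e /is_prefix_catl; exact: wq.
have [_ /(_ (mkseq (g (wcat w d)) k.+1))] := preim_lcpP wmq.
rewrite size_mkseq; apply=> e /= /is_prefixE eE.
rewrite /is_prefix size_mkseq -[e in mkseq e _]gK; apply: Hm.
rewrite eE wcat_cat; apply: mkseq_wcat_le.
set c := dropc _ _; have := is_prefix_wcat (mkseq d m) c.
by rewrite /is_prefix size_mkseq.
Qed.

(** The state [(w, q)] of the inverse transducer maps [d] to the preimage of
    [w d] under [T_q]. *)
Lemma run_inverse_state (s : inverse_state T q0) d :
  run T (proj1_sig s).2 (run S s d) = wcat (proj1_sig s).1 d.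
Proof.
have [wq _] := inverse_state_pair s.
have [c _ cd] := wq _ (is_prefix_wcat (proj1_sig s).1 d).
suff -> : run S s d = c by [].
apply: run_uniq => k; have [m km] := inverse_transducer_infinite s d k.
exists m => //; rewrite outw_inverse_transducer.
set u := _ ++ _; have uq : cone u `<=` range (run T (proj1_sig s).2).
  by move=> e /is_prefix_catl; exact: wq.
have [] := preim_lcpP uq => + _; apply; rewrite /= cd.
exact/is_prefix_catr/is_prefix_mkseq.
Qed.

Lemma run_inverse_init :
  run S (exist _ _ (accessible_init (inverse_pairs T) ([::], q0))) = inverse f.
Proof.
apply/funext => d; apply: (@run_state_inj q0).
set s := exist _ _ _; have := run_inverse_state s d.
by rewrite /= wcat0 => ->; rewrite -/f inverseVK.
Qed.

Lemma run_prod_inverse q (s : inverse_state T q0) d :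
  run T (proj1_sig s).2 (run (prod_transducer T S) (q, s) d) =
  wcat (proj1_sig s).1 (run T q d).
Proof.
by rewrite run_prod ?run_inverse_state //; exact: inverse_transducer_infinite.
Qed.

End Inverse_transducer.

(** * Conjugates of Thompson's group and completions *)

Section Conjugate.
Variables (n : nat) (Q : Type) (T : transducer n Q) (q0 : Q).
Hypothesis n_ge2 : 2 <= n.
Hypothesis T_inf : infinite_output T.
Hypothesis T_acc : forall q : Q, accessible T q0 q.
Hypothesis T_homeo : homeomorphism (run T q0).
Hypothesis T_sync : synchronizing T.

Let f := run T q0.
Let f_bij : bijective f := homeomorphism_bij T_homeo.
Let n_gt0 : 0 < n := ltnW n_ge2.
Let S := inverse_transducer T q0.
Let TS := prod_transducer T S.
Let S_inf : infinite_output S := inverse_transducer_infinite n_ge2 T_inf T_acc T_homeo.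

(** Reading a word of the synchronizing length forces the state. Hence if [h]
    acts near each point by a prefix replacement followed by maps that are
    intertwined by states [q] and [p] of the transducer, then the outputs of
    the initial state before and after [h] have, after reading finitely many
    letters, a common tail up to a fixed change of prefix. *)
Lemma conj_thompson_of_tails h : homeomorphism h ->
  (forall d, exists a b w p q, is_prefix a d /\
     forall c, exists2 z, h (wcat a c) = wcat b z
                        & run T p z = wcat w (run T q c)) ->
  conj_set (@thompson n) (inverse f) h.
Proof.
move=> hh hloc; apply/conj_thompsonP => //; split=> // d.
have [k [phi Hphi]] := T_sync.
have sync u q q' : size u = k -> transw T u q = transw T u q'.
  by move=> /eqP uk; rewrite (Hphi (Tuple uk)) (Hphi (Tuple uk)).
have [a [b [w [p [q [/is_prefixE xa Hab]]]]]] := hloc (inverse f d).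
set x := dropc _ _ in xa; have [y hy Ty] := Hab x.
pose u : word n := mkseq x k; pose v : word n := mkseq y k.
have uk : size u = k by exact: size_mkseq.
have vk : size v = k by exact: size_mkseq.
pose A := outw T (a ++ u) q0; pose B := w ++ outw T u q.
pose C := outw T v p; pose D := outw T (b ++ v) q0.
have [_ _ fic] := T_homeo; have [hc _ _] := hh.
have [m1 Hm1] := (continuous_cantorP _).1 fic d (size a + k).
have ihc := continuous_catcomp fic hc.
have [m2 Hm2] := (continuous_cantorP _).1 ihc d (size b + k).
(* The summands [size A] and [size C] make the prefix of [d] of length [m] long
   enough for the words [A] and [C] to be removed from it below. *)
pose m := maxn m1 m2 + (size A + size C).
have Ad : is_prefix A d.
  rewrite -(inverseVK f_bij d) xa -(wcat_mkseq x k) -wcat_cat /f run_wcat //.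
  exact: is_prefix_wcat.
pose r : word n := drop (size A) (mkseq d m).
have dm : mkseq d m = A ++ r.
  apply: (is_prefix_comparable Ad (is_prefix_mkseq d m)).
  by rewrite size_mkseq /m; lia.
have Cr : size C <= size (B ++ r).
  have mE : m = size A + size r by rewrite -(size_mkseq d m) dm size_cat.
  by rewrite size_cat; move: mE; rewrite /m; lia.
exists (mkseq d m), (D ++ drop (size C) (B ++ r)); split.
  exact: is_prefix_mkseq.
move=> e'; set e := wcat _ e'; have em : mkseq e m = mkseq d m.
  by have := is_prefix_wcat (mkseq d m) e'; rewrite /is_prefix size_mkseq.
have /Hm1 : mkseq e m1 = mkseq d m1 by apply: mkseq_le em; rewrite /m; lia.
rewrite xa mkseq_wcat -/u => ea.
have /Hm2 : mkseq e m2 = mkseq d m2 by apply: mkseq_le em; rewrite /m; lia.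
rewrite /= xa hy mkseq_wcat -/v => hb.
have {}ea : is_prefix (a ++ u) (inverse f e) by rewrite /is_prefix size_cat uk.
have {}hb : is_prefix (b ++ v) (h (inverse f e)).
  by rewrite /is_prefix size_cat vk.
have {ea} := is_prefixE ea; set x' := dropc _ _ => ea.
have [z hz Tz] := Hab (wcat u x'); rewrite -wcat_cat -ea in hz.
have {hb} := is_prefixE hb; set y' := dropc _ _ => hb.
have zE : z = wcat v y' by apply: (@wcat_inj _ b); rewrite -hz hb wcat_cat.
have tE : run T (transw T u q) x' = wcat r e'.
  apply: (@wcat_inj _ A); rewrite -wcat_cat -dm -/e -(inverseVK f_bij e) ea.
  by rewrite [RHS]run_wcat // transw_cat (sync _ _ q).
(* [T_p z = w (T_q c)] now reads [C t = B r e'], where [t] is the output on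
   [y']; as [B r] is at least as long as [C], the tail [t] is a word followed by
   [e']. *)
move: Tz; rewrite zE !run_wcat // tE -!wcat_cat => Tz.
have [_ sE] := wcat_split Tz Cr.
rewrite /= hb [LHS]run_wcat // transw_cat (sync v _ p) // sE.
by rewrite wcat_cat.
Qed.

(** With [v] in Thompson's group, [T_(q0) v T_(q0)^-1] maps [a c], for [a] long
    enough, to the image under [T_(q0)^-1] of [w' T_q(c)], where [q] is the
    state reached by [a] and [w'] a word; reading [w'] in the inverse transducer
    exhibits this as a word followed by the action of a state of the product. *)
Lemma conj_thompson_completion :
  conj_set (@thompson n) (inverse f) `<=` completion TS.
Proof.
move=> h /(conj_thompsonP _ n_gt0 T_homeo)[hh hl]; split=> //.
set v := inverse f \; h \; f in hl.
have vf d : h d = inverse f (v (f d)) by rewrite /= !inverseK.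
pose P a := exists w, forall c,
  v (f (wcat a c)) = wcat w (run T (transw T a q0) c).
have [m Hm] : exists m, forall a, size a = m -> P a.
  apply: fan => [a b [w Hw]|d].
    exists (w ++ outw T b (transw T a q0)) => c.
    by rewrite wcat_cat Hw run_wcat // transw_cat wcat_cat.
  have [u [w [ud uw]]] := hl (f d); have [m /ltnW Hm] := T_inf q0 d (size u).
  have uE := is_prefix_comparable ud (run_prefix T q0 d m) Hm.
  exists m, (w ++ drop (size u) (outw T (mkseq d m) q0)) => c.
  by rewrite /f run_wcat // uE wcat_cat uw wcat_cat -uE.
have [w Hw] := choice (fun i => Hm _ (@size_level n m i)).
pose s0 : inverse_state T q0 :=
  exist _ _ (accessible_init (inverse_pairs T) ([::], q0)).
pose rho i := outw S (w i) s0.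
pose p i := (transw T (level i) q0, transw S (w i) s0).
have hE i c : h (wcat (level i) c) = wcat (rho i) (run TS (p i) c).
  rewrite vf Hw -(run_inverse_init n_ge2 T_inf T_acc T_homeo).
  by rewrite run_wcat // run_prod.
have aP := level_antichain m n_gt0; have [_ aP2 _] := aP.
exists _, rho, p, (@level n m); split=> //.
- split; first apply/seteqP; first split=> // d _.
    have [i /is_prefixE di] := antichain_cover aP (inverse h d); exists i => //.
    rewrite -(inverseVK (homeomorphism_bij hh) d) di hE.
    by apply/imageP/imageP.
  move=> i j ij; apply/seteqP; split=> // d [] /= [_ [c _ <-] cd] [_ [c' _ <-]].
  rewrite -cd -!hE => /(homeomorphism_inj hh) cc'; apply: ij; apply: aP2 => //.
  exists (wcat (level i) c); split; first exact: is_prefix_wcat.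
  by rewrite -cc'; exact: is_prefix_wcat.
- exact: card_level_mod.
Qed.

Lemma completion_conj_thompson :
  completion TS `<=` conj_set (@thompson n) (inverse f).
Proof.
move=> h [hh [l [rho [p [eta [_ _ eP hE]]]]]].
apply: conj_thompson_of_tails => // d.
have [i di] := antichain_cover eP d.
exists (eta i), (rho i), (proj1_sig (p i).2).1, (proj1_sig (p i).2).2, (p i).1.
split=> // c; exists (run TS (p i) c) => //.
rewrite (surjective_pairing (p i)); exact: run_prod_inverse.
Qed.

(** The completions already form a group. *)
Lemma completion_group_eq :
  conj_set (@thompson n) (inverse f) = completion_group TS.
Proof.
apply/seteqP; split=> h.
  by move=> /conj_thompson_completion hc G [_]; exact.
apply; split; first exact: conj_thompson_subgroup.
exact: completion_conj_thompson.
Qed.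

End Conjugate.

(** * Maps acting below a word *)

(** The map that sends [a c] to [a (c g)] and fixes the points outside the
    cone of [a]. *)
Definition below n (a : word n) (g : cantor n -> cantor n) : cantor n -> cantor n :=
  fun d => if mkseq d (size a) == a then wcat a (g (dropc (size a) d)) else d.

Lemma below_wcat n (a : word n) g c : below a g (wcat a c) = wcat a (g c).
Proof. by rewrite /below is_prefix_wcat eqxx dropc_wcat. Qed.

Lemma below_out n (a : word n) g d : ~ cone a d -> below a g d = d.
Proof. by rewrite /below; case: eqP. Qed.

Lemma belowP n (a : word n) g h : acts_below a g h -> h = below a g.
Proof.
move=> [h1 h2]; apply/funext => d; have [da|nda] := pselect (cone a d).
  by rewrite (is_prefixE da) below_wcat h1.
by rewrite below_out // h2.
Qed.

Lemma acts_below_below n (a : word n) g : acts_below a g (below a g).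
Proof. by split; [exact: below_wcat | exact: below_out]. Qed.

Lemma below_id n (a : word n) : below a id = id.
Proof. by apply/esym/belowP. Qed.

Lemma below_comp n (a : word n) g h : below a (g \; h) = below a g \; below a h.
Proof.
apply/esym/belowP; split=> [c|d da] /=; first by rewrite !below_wcat.
by rewrite !below_out.
Qed.

Lemma below_continuous n (a : word n) g : continuous g -> continuous (below a g).
Proof.
move=> gc; apply/continuous_cantorP => d k.
have [da|nda] := pselect (cone a d).
  have bc : continuous (@dropc n (size a) \; g \; @wcat n a).
    apply: continuous_catcomp (@wcat_continuous n a).
    exact: continuous_catcomp (@dropc_continuous n (size a)) gc.
  have [m Hm] := (continuous_cantorP _).1 bc d k.
  exists (maxn m (size a)) => e em.
  rewrite /below (mkseq_le (leq_maxr _ _) em) da eqxx; apply: Hm.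
  exact: mkseq_le (leq_maxl _ _) em.
exists (maxn k (size a)) => e em; rewrite !below_out //.
  exact: mkseq_le (leq_maxl _ _) em.
by rewrite /cone /= /is_prefix (mkseq_le (leq_maxr _ _) em).
Qed.

Lemma below_cancel n (a : word n) (g h : cantor n -> cantor n) :
  cancel g h -> cancel (below a g) (below a h).
Proof.
move=> gK d; have gh : g \; h = id by apply/funext.
by have := below_comp a g h; rewrite gh below_id => /(congr1 (@^~ d)).
Qed.

Lemma below_homeomorphism n (a : word n) g :
  homeomorphism g -> homeomorphism (below a g).
Proof.
move=> [gc gb gic]; apply: (@homeomorphismI _ _ (below a (inverse g))).
- exact: below_continuous.
- exact: below_continuous.
- exact/below_cancel/inverseK.
- exact/below_cancel/inverseVK.
Qed.

Lemma below_inverse n (a : word n) g : homeomorphism g ->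
  below a (inverse g) = inverse (below a g).
Proof.
move=> gh; apply/esym/inverse_uniq.
  exact/homeomorphism_bij/below_homeomorphism.
exact/below_cancel/inverseVK/homeomorphism_bij.
Qed.

Lemma below_subgroup n (C : set (cantor n -> cantor n)) : is_subgroup C ->
  is_subgroup [set g | homeomorphism g /\ forall a, C (below a g)].
Proof.
move=> [Ch C1 CM CV]; split.
- by move=> g [].
- by split; [exact: homeomorphism_id | move=> a; rewrite below_id].
- move=> g h [gh gC] [hh hC]; split; first exact: homeomorphism_comp.
  by move=> a; rewrite below_comp; exact: CM.
- move=> g [gh gC]; split; first exact: homeomorphism_inverse.
  by move=> a; rewrite below_inverse //; exact: CV.
Qed.

(** * Completions of a transducer whose states are homeomorphisms *)

(** Such a completion [eta_i c |-> rho_i T_(p_i)(c)] is the product of the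
    maps acting as [T_(p_i)] below [eta_i], followed by the prefix replacement
    [eta_i c |-> rho_i c]. *)
Lemma completion_thompson_ext n Q (T : transducer n Q) : 0 < n ->
  (forall q, homeomorphism (run T q)) ->
  completion T `<=` thompson_ext (state_group T).
Proof.
move=> n0 Th h [hh [l [rho [p [eta [_ _ eP hE]]]]]] G [Gsub Ggen].
have [Gh G1 GM GV] := Gsub.
have Gbelow i : G (below (eta i) (run T (p i))).
  apply: Ggen; right; exists (eta i), (run T (p i)); split; last exact: acts_below_below.
  by move=> H [_]; apply; exists (p i).
have etaP i j c : is_prefix (eta j) (wcat (eta i) c) -> i = j.
  move=> cj; have [_ + _] := eP; apply=> //.
  by exists (wcat (eta i) c); split=> //; exact: is_prefix_wcat.
have [K GK KE] : exists2 K, G K &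
    forall i c, K (wcat (eta i) c) = wcat (eta i) (run T (p i) c).
  (* Compose the maps below [eta_0], ..., [eta_(k-1)] one after the other. *)
  have part k : k <= l -> exists2 K, G K & forall (i : 'I_l) c,
      K (wcat (eta i) c) = wcat (eta i) (if i < k then run T (p i) c else c).
    elim: k => [_|k IH kl]; first by exists id.
    have [K GK KE] := IH (ltnW kl); pose j := Ordinal kl.
    exists (K \; below (eta j) (run T (p j))); first exact: GM.
    move=> i c; rewrite /= KE ltnS; have [ij|ij] := eqVneq i j.
      by rewrite ij ltnn leqnn below_wcat.
    rewrite below_out; last by move=> /etaP/eqP; rewrite (negPf ij).
    by rewrite [i <= k]leq_eqVlt (_ : (nat_of_ord i == k) = false) //; exact: negPf.
  have [K GK KE] := part l (leqnn l).
  by exists K => // i c; rewrite KE ltn_ord.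
have Kh := Gh _ GK; have Kb := homeomorphism_bij Kh.
have VK : thompson (inverse K \; h).
  apply/thompsonP => //; split.
    exact: homeomorphism_comp (homeomorphism_inverse Kh) hh.
  move=> d; have [i di] := antichain_cover eP d; exists (eta i), (rho i).
  split=> // e; have pb := homeomorphism_bij (Th (p i)).
  by rewrite /= -{1}(inverseVK pb e) -KE inverseK // hE inverseVK.
have -> : h = K \; (inverse K \; h) by apply/funext => d /=; rewrite inverseK.
by apply: GM => //; apply: Ggen; left.
Qed.

(** * Synchronous transducers *)

Section Synchronous.
Variables (n : nat) (Q : Type) (T : transducer n Q) (q0 : Q).
Hypothesis n_ge2 : 2 <= n.
Hypothesis T_inf : infinite_output T.
Hypothesis T_acc : forall q : Q, accessible T q0 q.
Hypothesis T_homeo : homeomorphism (run T q0).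
Hypothesis T_synchronous : synchronous T.

Let f := run T q0.
Let f_bij : bijective f := homeomorphism_bij T_homeo.
Let n_gt0 : 0 < n := ltnW n_ge2.
Let S := inverse_transducer T q0.
Let TS := prod_transducer T S.

Lemma size_outw u q : size (outw T u q) = size u.
Proof. by elim: u q => //= x u IH q; rewrite size_cat T_synchronous IH. Qed.

(** On words of a given length the initial state is onto, hence one-to-one. *)
Lemma outw_init_inj u v :
  size u = size v -> outw T u q0 = outw T v q0 -> u = v.
Proof.
move=> uv; pose m := size v.
have Fsz (t : m.-tuple 'I_n) : size (outw T t q0) == m by rewrite size_outw size_tuple.
pose F t := Tuple (Fsz t).
have Fsurj t : exists t', F t' = t.
  pose d := inverse f (wcat t (fun=> Ordinal n_gt0)).
  have dsz : size (mkseq d m) == m by rewrite size_mkseq.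
  exists (Tuple dsz); apply: val_inj => /=.
  have := run_prefix T q0 d m; rewrite -/f inverseVK // => /is_prefixE E.
  by have [] := wcat_eqsize (esym E) _; rewrite // size_outw size_mkseq size_tuple.
have [g gK] := choice Fsurj.
have FK : cancel F g by apply: canF_sym.
have /eqP um : size u = m by []. have /eqP vm : size v = m by [].
move=> E; suff /(congr1 val) : Tuple um = Tuple vm by [].
by apply: (can_inj FK); apply: val_inj.
Qed.

Lemma outw_inj q u v : size u = size v -> outw T u q = outw T v q -> u = v.
Proof.
have [a <-] := T_acc q => uv E.
have : a ++ u = a ++ v by apply: outw_init_inj; rewrite ?size_cat ?uv // !outw_cat E.
by move/eqP; rewrite eqseq_cat // => /andP[_ /eqP].
Qed.

Lemma run_state_homeomorphism q : homeomorphism (run T q).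
Proof.
have [g gc gK] := run_state_retract T_inf T_acc T_homeo q.
apply: (homeomorphismI (run_continuous T_inf (q := q)) gc gK) => d.
suff [c <-] : exists c, run T q c = d by rewrite gK.
have [a aq] := T_acc q; pose x := inverse f (wcat (outw T a q0) d).
have xE := inverseVK f_bij (wcat (outw T a q0) d); rewrite -/x in xE.
have fx := wcat_mkseq x (size a); set y := dropc _ _ in fx.
rewrite -fx /f run_wcat // in xE.
have [|E] := wcat_eqsize xE; first by rewrite !size_outw size_mkseq.
have {}E := outw_init_inj (size_mkseq _ _) E.
by rewrite E aq => yd; exists y.
Qed.

(** A synchronous [T] being a bijection on letters at each state, its inverse
    has no pending output: the word component of each state is empty. *)
Lemma inverse_state_nil (s : inverse_state T q0) : (proj1_sig s).1 = [::].
Proof.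
case: s => p [u] /= <-.
have : (([::], q0) : word n * Q).1 = [::] by [].
have := inverse_pair_init n_ge2 T_homeo.
elim: u ([::], q0) => [|x u IH] [w q] //= qp w0; apply: IH.
  by have [] := preim_lcp_step n_ge2 T_inf x qp.1.
rewrite w0 in qp *; rewrite /=; set v := preim_lcp _ _ _.
have xq : cone [:: x] `<=` range (run T q).
  by move=> d _; exact: (qp.1 d).
have [d [_ [dx _ _]]] := cone_points [:: x] n_ge2.
have [c _ cd] := xq d dx; rewrite -cd in dx.
have out1 e : cone [:: x] (run T q e) -> outw T (mkseq e 1) q = [:: x].
  move=> ex; have := run_prefix T q e 1.
  by rewrite /is_prefix size_outw size_mkseq => <-.
have [_ /(_ (mkseq c 1))] := preim_lcpP n_ge2 xq.
rewrite -/v size_mkseq => v1; apply: size0nil; rewrite size_drop size_outw /=.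
apply/eqP; rewrite subn_eq0; apply: v1 => e /= ex.
rewrite /is_prefix size_mkseq; apply: (@outw_inj q); first by rewrite !size_mkseq.
by rewrite !out1.
Qed.

Lemma run_prod_homeomorphism p : homeomorphism (run TS p).
Proof.
case: p => q s; pose r := (proj1_sig s).2.
have rh := run_state_homeomorphism r; have rb := homeomorphism_bij rh.
suff -> : run TS (q, s) = run T q \; inverse (run T r).
  apply: homeomorphism_comp (homeomorphism_inverse rh).
  exact: run_state_homeomorphism.
apply/funext => d; apply: (bij_inj rb); rewrite /= inverseVK //.
by have := run_prod_inverse n_ge2 T_inf T_acc T_homeo q s d; rewrite inverse_state_nil wcat0.
Qed.

Hypothesis T_sync : synchronizing T.

(** For a fixed subgroup [C], the maps [g] that yield elements of [C] below
    every word form a group; hence only the generators [T_q T_p^-1] are to be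
    checked. *)
Lemma thompson_ext_conj :
  thompson_ext (state_group TS) `<=` conj_set (@thompson n) (inverse f).
Proof.
have Csub := conj_thompson_subgroup n_gt0 T_homeo.
move=> h; apply; split=> // {}h [/(thompsonP _ n_gt0)[hh hl]|[a [g [gS /belowP ->]]]].
  apply: conj_thompson_of_tails => // d; have [u [v [ud uv]]] := hl d.
  by exists u, v, [::], q0, q0; split=> // c; exists c; rewrite ?wcat0.
suff below_states : range (run TS) `<=`
    [set k | homeomorphism k /\ forall b, conj_set (@thompson n) (inverse f) (below b k)].
  by have [_ gC] := gS _ (conj (below_subgroup Csub) below_states); exact: gC.
move=> _ [[q s] _ <-]; have gh := run_prod_homeomorphism (q, s); split=> // b.
apply: conj_thompson_of_tails => //; first exact: below_homeomorphism.
move=> d.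
have [db|db] := pselect (cone b d).
  exists b, b, [::], (proj1_sig s).2, q; split=> // c.
  exists (run TS (q, s) c); first exact: below_wcat.
  by rewrite run_prod_inverse // inverse_state_nil.
exists (mkseq d (size b)), (mkseq d (size b)), [::], q0, q0.
split=> [|c]; first exact: is_prefix_mkseq.
exists c; last by rewrite wcat0.
apply: below_out => cb; apply: db; have := is_prefix_wcat (mkseq d (size b)) c.
by rewrite /is_prefix size_mkseq => E; exact: etrans (esym E) cb.
Qed.

Lemma thompson_ext_eq :
  conj_set (@thompson n) (inverse f) = thompson_ext (state_group TS).
Proof.
apply/seteqP; split; last exact: thompson_ext_conj.
move=> h hc; apply: (completion_thompson_ext n_gt0 run_prod_homeomorphism).
exact: conj_thompson_completion.
Qed.

End Synchronous.

Theorem theorem1p2 (n : nat) (Q : finType) (T : transducer n Q) (q0 : Q)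
  (n_ge2 : 2 <= n)
  (T_inf : infinite_output T)
  (T_acc : forall q : Q, accessible T q0 q)
  (T_homeo : homeomorphism (run T q0))
  (T_sync : one_way_synchronizing T q0) :
  let TS := prod_transducer T (inverse_transducer T q0) in
  conj_set (@thompson n) (inverse (run T q0)) = completion_group TS /\
  (synchronous T ->
   conj_set (@thompson n) (inverse (run T q0)) =
     thompson_ext (state_group TS)).
Proof.
have [sync _] := T_sync; split; first exact: completion_group_eq.
by move=> T_synchronous; exact: thompson_ext_eq.
Qed.
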